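(* Let $G$ be a simple connected graph on $n\ge 3$ vertices, with vertex set $I=\{1,\ldots,n\}$, having a dominating vertex $i$ (i.e. $d_i=n-1$), and let $\lambda_1\ge\cdots\ge\lambda_n$ be the eigenvalues of its normalized adjacency matrix $D^{-1}A$. Then $$\lambda_n\ge-\frac{1}{n-1}-\max_{\substack{j,k\in I\setminus\{i\}\\ j\neq k}}\sqrt{\Big(2-\frac{1}{d_j}-\frac{2d_j-1}{n-1}\Big)\Big(2-\frac{1}{d_k}-\frac{2d_k-1}{n-1}\Big)}$$ and $$\lambda_2\le-\frac{1}{n-1}+\max_{\substack{j,k\in I\setminus\{i\}\\ j\neq k}}\sqrt{\Big(2-\frac{1}{d_j}-\frac{2d_j-1}{n-1}\Big)\Big(2-\frac{1}{d_k}-\frac{2d_k-1}{n-1}\Big)}.$$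
   Context: $d_k$ denotes the degree of vertex $k$. $A$ is the adjacency matrix, $D$ the diagonal degree matrix, and $D^{-1}A$ the normalized adjacency matrix (with real eigenvalues). *)

(* Defs.v *)
From mathcomp Require Import all_boot all_order all_algebra.

Set Implicit Arguments.
Unset Strict Implicit.
Unset Printing Implicit Defensive.

Import Order.TTheory GRing.Theory Num.Theory.
Local Open Scope ring_scope.

Definition simple_graph (T : finType) (e : rel T) : Prop :=
  symmetric e /\ irreflexive e.

Definition connected_graph (T : finType) (e : rel T) : Prop :=
  forall x y : T, connect e x y.

Definition degree (T : finType) (e : rel T) (x : T) : nat := #|[set y | e x y]|.

Definition adjacency_mx (R : nzRingType) (n : nat) (e : rel 'I_n) : 'M[R]_n :=
  \matrix_(j, k) (e j k)%:R.

Definition degree_mx (R : nzRingType) (n : nat) (e : rel 'I_n) : 'M[R]_n :=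
  diag_mx (\row_j (degree e j)%:R).

Definition normalized_adjacency_mx (R : fieldType) (n : nat) (e : rel 'I_n) :
    'M[R]_n :=
  invmx (degree_mx R e) *m adjacency_mx R e.

(* Counted with algebraic multiplicity; [>=%R] makes the list nonincreasing.
   Indices are 0-based: lambda_k is lam`_(k.-1). *)
Definition ordered_eigenvalues (R : realFieldType) (n : nat) (M : 'M[R]_n)
    (lam : n.-tuple R) : Prop :=
  sorted >=%R lam /\ char_poly M = \prod_(x <- lam) ('X - x%:P).

Definition radius_factor (R : fieldType) (n : nat) (e : rel 'I_n) (j : 'I_n) : R :=
  let d : R := (degree e j)%:R in
  2 - 1 / d - (2 * d - 1) / (n%:R - 1).

(* The default value 0 does not affect the maximum: the index set is nonempty
   when n >= 3 and the square roots are nonnegative. *)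
Definition max_radius (R : rcfType) (n : nat) (e : rel 'I_n) (i : 'I_n) : R :=
  \big[Num.max/0]_(p : 'I_n * 'I_n | [&& p.1 != i, p.2 != i & p.1 != p.2])
    Num.sqrt (radius_factor R e p.1 * radius_factor R e p.2).

(* Main.v *)
(**
Subtracting from every row of the stochastic matrix D^-1 A its i-th row, and
then deleting row and column i, removes one copy of the eigenvalue 1 from the
spectrum and keeps the others.  As i is dominating, row i of D^-1 A is constant
1/(n-1) off i, so the deflated matrix has constant diagonal -1/(n-1), and its
deleted absolute row sums are exactly the factors under the square roots.
Brauer's ovals of Cassini for this matrix give the two bounds.
*)

Require Import Defs.
From mathcomp Require Import all_boot all_order all_algebra.
From mathcomp Require Import ring lra.

Set Implicit Arguments.
Unset Strict Implicit.
Unset Printing Implicit Defensive.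

Import Order.TTheory GRing.Theory Num.Theory.
Local Open Scope ring_scope.

(** * Removing one eigenvalue from a matrix with constant row sums *)

(** If all row sums of [A] agree, this is the matrix induced by [A] on column vectors modulo the
    all-ones vector, in the basis of the unit vectors other than the [i]-th. *)
Definition deflation (R : pzRingType) (n : nat) (A : 'M[R]_n.+1) (i : 'I_n.+1) :
    'M[R]_n :=
  \matrix_(j, k) (A (lift i j) (lift i k) - A i (lift i k)).

Lemma char_poly_deflation (R : comNzRingType) (n : nat) (A : 'M[R]_n.+1)
    (i : 'I_n.+1) (c : R) :
  (forall j, \sum_k A j k = c) ->
  char_poly A = ('X - c%:P) * char_poly (deflation A i).
Proof.
move=> sumA; pose C := char_poly_mx A.
(* S replaces the i-th basis vector by the all-ones eigenvector. *)
pose S : 'M[{poly R}]_n.+1 :=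
  \matrix_(j, k) (if k == i then 1 else (j == k)%:R).
(* [D] is S^-1 C S. Multiplying by S^-1 on the left subtracts row [i] from the other rows, and
   column [i] vanishes off the diagonal. *)
pose D : 'M[{poly R}]_n.+1 :=
  \matrix_(j, k) (if k == i then (j == i)%:R * ('X - c%:P)
                  else C j k - (j != i)%:R * C i k).
have SE j k : S j k = if k == i then 1 else (j == k)%:R by rewrite mxE.
have DE j k : D j k = if k == i then (j == i)%:R * ('X - c%:P)
                      else C j k - (j != i)%:R * C i k by rewrite mxE.
have pick (j0 : 'I_n.+1) (f : 'I_n.+1 -> {poly R}) :
    \sum_l (l == j0)%:R * f l = f j0.
  rewrite (bigD1 j0) //= eqxx mul1r big1 ?addr0 // => l /negbTE ->.
  by rewrite mul0r.
have sumC j : \sum_k C j k = 'X - c%:P.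
  rewrite (eq_bigr (fun k => (j == k)%:R * 'X - (A j k)%:P)); last first.
    by move=> k _; rewrite !mxE mulr_natl.
  rewrite sumrB -mulr_suml -(sumA j) rmorph_sum /=; congr (_ - _).
  rewrite (bigD1 j) //= eqxx big1 ?addr0 ?mul1r // => k.
  by rewrite eq_sym => /negbTE ->.
have detS : \det S = 1.
  rewrite (expand_det_row _ i) (bigD1 i) //= big1 => [|k ki]; last first.
    by rewrite mxE (negbTE ki) eq_sym (negbTE ki) mul0r.
  rewrite mxE eqxx mul1r addr0 /cofactor addnn -signr_odd odd_double mul1r.
  rewrite (_ : row' i (col' i S) = 1%:M) ?det1 //.
  apply/matrixP => j k; rewrite !mxE eq_sym (negbTE (neq_lift _ _)).
  by rewrite (inj_eq lift_inj).
have CS : C *m S = S *m D.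
  apply/matrixP => j k; rewrite !mxE.
  (* Row [j] of [S] has a 1 at [i] and, if [j] differs from [i], another at [j]; split this way, the
     sum collapses by [pick]. *)
  rewrite [RHS](eq_bigr (fun l => (l == i)%:R * D l k
      + (l == j)%:R * ((l != i)%:R * D l k))); last first.
    move=> l _; rewrite !SE; case: eqP => [->|_] /=.
      by rewrite !mul0r mulr0 addr0.
    by rewrite eq_sym mul0r add0r mul1r.
  rewrite big_split /= !pick.
  rewrite !DE; case: (eqVneq k i) => [->|ki].
    rewrite (eq_bigr (C j)) => [|l _]; last by rewrite !SE eqxx mulr1.
    by rewrite sumC eqxx; case: eqP => _ /=; ring.
  rewrite (bigD1 k) //= big1 => [|l lk]; last first.
    by rewrite !SE (negbTE ki) (negbTE lk) mulr0.
  rewrite !SE (negbTE ki) eqxx mulr1 eqxx /=.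
  by case: eqP => [->|_] /=; ring.
have -> : char_poly A = \det D.
  by have := congr1 determinant CS; rewrite !det_mulmx detS mulr1 mul1r.
rewrite (expand_det_col _ i) (bigD1 i) //= big1 => [|k ki]; last first.
  by rewrite mxE eqxx (negbTE ki) !mul0r.
rewrite mxE !eqxx mul1r addr0 /cofactor addnn -signr_odd odd_double mul1r.
congr (_ * \det _); apply/matrixP => j k; rewrite !mxE.
rewrite ![lift i _ == i]eq_sym !(negbTE (neq_lift _ _)) /=.
by rewrite !(inj_eq lift_inj) mul1r mulr0n sub0r polyCB; ring.
Qed.

Lemma char_poly_trmx (R : comNzRingType) (n : nat) (A : 'M[R]_n) :
  char_poly A^T = char_poly A.
Proof.
rewrite /char_poly -[RHS]det_tr; congr (\det _).
by apply/matrixP => j k; rewrite !mxE eq_sym.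
Qed.

(** * Brauer's ovals of Cassini *)

(** [eigenvalue] speaks of row vectors, whereas estimates by row sums need a column eigenvector;
    transposing [A] converts one into the other. *)
Lemma eigenvalue_col (F : fieldType) (n : nat) (A : 'M[F]_n) (a : F) :
  root (char_poly A) a ->
  exists2 x : 'I_n -> F, (exists j, x j != 0)
    & forall j, \sum_k A j k * x k = a * x j.
Proof.
rewrite -char_poly_trmx -eigenvalue_root_char => /eigenvalueP [v vA v0].
exists (v ord0) => [|j]; first by case/rV0Pn: v0 => j vj; exists j.
have /matrixP /(_ ord0 j) := vA; rewrite !mxE => <-.
by apply: eq_bigr => k _; rewrite mxE mulrC.
Qed.

Definition deleted_row_sum (R : numDomainType) (n : nat) (A : 'M[R]_n) (j : 'I_n) : R :=
  \sum_(k | k != j) `|A j k|.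

(* Compare the eigenvector equation at the two coordinates of largest modulus. *)
Lemma brauer_cassini (R : realFieldType) (n : nat) (A : 'M[R]_n) (a : R) :
  (1 < n)%N -> root (char_poly A) a ->
  exists j k, j != k /\
    `|a - A j j| * `|a - A k k| <= deleted_row_sum A j * deleted_row_sum A k.
Proof.
move=> n_gt1 /eigenvalue_col [x [j0 xj0] Ax].
have [p _ maxp] := arg_maxP (fun j => `|x j|) (isT : predT j0).
have [q0 q0p] : exists q, q != p.
  have : (0 < #|[set~ p]|)%N.
    by rewrite cardsC1 card_ord -subn1 subn_gt0.
  by case/card_gt0P => q; rewrite !inE; exists q.
have [q qp maxq] := arg_maxP (P := [pred j | j != p]) (fun j => `|x j|) q0p.
have xp_gt0 : 0 < `|x p| by apply: lt_le_trans (maxp j0 isT); rewrite normr_gt0.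
have bound j m : (forall k, k != j -> `|x k| <= m) ->
    `|a - A j j| * `|x j| <= deleted_row_sum A j * m.
  move=> xm; have := Ax j; rewrite (bigD1 j) //= => E.
  have {E} : (a - A j j) * x j = \sum_(k | k != j) A j k * x k.
    by rewrite mulrBl -E; ring.
  rewrite -normrM => ->; apply: le_trans (ler_norm_sum _ _ _) _.
  rewrite /deleted_row_sum mulr_suml; apply: ler_sum => k kj.
  by rewrite normrM ler_wpM2l // xm.
have bp := bound p _ maxq.
have bq := bound q _ (fun k _ => maxp k isT).
have row_ge0 j : 0 <= deleted_row_sum A j by apply: sumr_ge0.
exists p, q; split; first by rewrite eq_sym.
(* If [x q] vanishes, the bound at [p] forces [a = A p p]. Otherwise the two bounds are multiplied
   and the common factor [|x p| |x q|] cancels. *)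
have [xq0|xq_gt0] := eqVneq (x q) 0.
  move: bp; rewrite xq0 normr0 mulr0 pmulr_lle0 // normr_le0 => /eqP ->.
  by rewrite normr0 mul0r mulr_ge0.
rewrite -normr_gt0 in xq_gt0.
rewrite -(ler_pM2r (mulr_gt0 xp_gt0 xq_gt0)).
have := ler_pM (mulr_ge0 (normr_ge0 _) (normr_ge0 _))
  (mulr_ge0 (normr_ge0 _) (normr_ge0 _)) bp bq.
by rewrite mulrACA [X in _ <= X]mulrACA [`|x q| * `|x p|]mulrC.
Qed.

(** * The normalized adjacency matrix of a graph with a dominating vertex *)

Lemma sum_adjacency (R : nzRingType) (n : nat) (e : rel 'I_n) (j : 'I_n) :
  \sum_k (e j k)%:R = (degree e j)%:R :> R.
Proof. by rewrite -natr_sum -big_mkcond /= sum1_card /degree cardsE. Qed.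

Lemma normalized_adjacency_mxE (R : numFieldType) (n : nat) (e : rel 'I_n)
    (j k : 'I_n) :
  (forall l, 0 < degree e l)%N ->
  normalized_adjacency_mx R e j k = (e j k)%:R / (degree e j)%:R.
Proof.
move=> deg_gt0; have nz l : (degree e l)%:R != 0 :> R.
  by rewrite pnatr_eq0 -lt0n.
have uD : degree_mx R e \in unitmx.
  rewrite unitmxE det_diag unitfE; apply/prodf_neq0 => l _; rewrite mxE; exact: nz.
have /matrixP /(_ j k) := mulKVmx uD (adjacency_mx R e).
by rewrite mul_diag_mx !mxE => /(canRL (mulKf (nz j))) ->; rewrite mulrC.
Qed.

(** Counting: without loops the neighbourhood of [i] lies in the complement of [i], and both have
    n-1 elements. *)
Lemma dominating_adj (n : nat) (e : rel 'I_n) (i j : 'I_n) :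
  irreflexive e -> degree e i = n.-1 -> j != i -> e i j.
Proof.
move=> irr_e deg_i ji.
have sub : [set y | e i y] \subset [set~ i].
  by apply/subsetP => y; rewrite !inE; apply: contraTneq => ->; rewrite irr_e.
have /eqP E : [set y | e i y] == [set~ i].
  by rewrite eqEcard sub cardsC1 card_ord -deg_i /degree leqnn.
have : j \in [set~ i] by rewrite !inE.
by rewrite -E inE.
Qed.

Lemma degree_dominated_gt0 (n : nat) (e : rel 'I_n) (i j : 'I_n) :
  (1 < n)%N -> simple_graph e -> degree e i = n.-1 -> (0 < degree e j)%N.
Proof.
move=> n_gt1 [sym_e irr_e] deg_i; case: (eqVneq j i) => [->|ji].
  by rewrite deg_i -subn1 subn_gt0.
by apply/card_gt0P; exists i; rewrite inE sym_e (dominating_adj irr_e deg_i ji).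
Qed.

Lemma deleted_row_sum_deflation (R : realFieldType) (m : nat) (e : rel 'I_m.+1)
    (i : 'I_m.+1) (j : 'I_m) :
  simple_graph e -> degree e i = m ->
  deleted_row_sum (deflation (normalized_adjacency_mx R e) i) j =
    radius_factor R e (lift i j).
Proof.
move=> simple_e deg_i; have m_gt0 : (0 < m)%N by case: m j {e i simple_e deg_i} => [[]|].
have deg_gt0 l : (0 < degree e l)%N by apply: (degree_dominated_gt0 l _ simple_e deg_i).
have [sym_e irr_e] := simple_e.
have adj k : e i (lift i k).
  by apply: (dominating_adj irr_e deg_i); rewrite eq_sym neq_lift.
set d : R := (degree e (lift i j))%:R; set mR : R := m%:R.
have d_gt0 : 0 < d by rewrite ltr0n.
have mR_gt0 : 0 < mR by rewrite ltr0n.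
(* This fixes the sign of 1/d - 1/m, the entry of the deflation at an edge. *)
have d_le : d <= mR.
  rewrite ler_nat.
  have /= := cardsC1 (lift i j); rewrite card_ord /= => cardE.
  apply: leq_trans (eq_leq cardE); apply: subset_leq_card.
  apply/subsetP => y; rewrite !inE; apply: contraTneq => ->.
  by rewrite irr_e.
(* The modulus is 1/d - 1/m at an edge and 1/m elsewhere. Written as an affine function of the
   adjacency entry, its sum only requires counting neighbours. *)
have entry k : `|deflation (normalized_adjacency_mx R e) i j k| =
    (e (lift i j) (lift i k))%:R * (1 / d - 2 / mR) + 1 / mR.
  rewrite mxE !normalized_adjacency_mxE // adj deg_i -/d -/mR.
  case: (e _ _) => /=.
    rewrite ger0_norm; first by ring.
    by rewrite subr_ge0 !mul1r lef_pV2.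
  by rewrite mul0r sub0r normrN ger0_norm ?divr_ge0 ?ltW // mul0r add0r.
(* The neighbour lost from the [d] is the dominating vertex [i]; the omitted index [j] contributes
   no loop. *)
have count : \sum_(k | k != j) (e (lift i j) (lift i k))%:R = d - 1 :> R.
  rewrite /d -sum_adjacency (bigD1_ord i) //= sym_e adj [in RHS](bigD1 j) //=.
  by rewrite irr_e /= add0r addrAC subrr add0r.
rewrite /deleted_row_sum (eq_bigr _ (fun k _ => entry k)) big_split /= -mulr_suml.
rewrite count sumr_const cardC1 card_ord -[_ *+ m.-1]mulr_natr -subn1 natrB //.
rewrite /radius_factor -/d -natr1 -/mR; field.
by rewrite addrC addKr !gt_eqF.
Qed.

(** The diagonal is constantly -1/m, so both factors of Brauer's inequality coincide and every oval
    is a disk centred at -1/m; a square root gives its radius. *)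
Lemma eigenvalue_deflation_bound (R : rcfType) (m : nat) (e : rel 'I_m.+1)
    (i : 'I_m.+1) (a : R) :
  (1 < m)%N -> simple_graph e -> degree e i = m ->
  root (char_poly (deflation (normalized_adjacency_mx R e) i)) a ->
  `|a + 1 / m%:R| <= max_radius R e i.
Proof.
move=> m_gt1 simple_e deg_i /(brauer_cassini m_gt1) [j [k [jk]]].
have deg_gt0 l : (0 < degree e l)%N.
  by apply: (degree_dominated_gt0 l _ simple_e deg_i); apply: ltnW.
have [_ irr_e] := simple_e.
have diag l : deflation (normalized_adjacency_mx R e) i l l = - (1 / m%:R).
  rewrite mxE !normalized_adjacency_mxE // irr_e mul0r sub0r deg_i.
  by rewrite (dominating_adj irr_e deg_i) // eq_sym neq_lift.
rewrite !diag opprK !deleted_row_sum_deflation //.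
rewrite -normrM -expr2 ger0_norm ?sqr_ge0 //.
move=> /ler_wsqrtr; rewrite sqrtr_sqr => /le_trans; apply.
apply: (le_bigmax_cond _ (j := (lift i j, lift i k))).
by rewrite /= ![lift i _ == i]eq_sym !neq_lift (inj_eq lift_inj).
Qed.

Theorem theorem4p7 (R : rcfType) (n : nat) (e : rel 'I_n) (i : 'I_n)
    (lam : n.-tuple R)
    (n_ge3 : (3 <= n)%N)
    (simple_e : simple_graph e)
    (connected_e : connected_graph e)
    (dominating_i : degree e i = n.-1)
    (eigen_lam : ordered_eigenvalues (normalized_adjacency_mx R e) lam) :
  lam`_(n.-1) >= - (1 / (n%:R - 1)) - max_radius R e i /\
  lam`_1 <= - (1 / (n%:R - 1)) + max_radius R e i.
Proof.
case: n e i lam n_ge3 simple_e connected_e dominating_i eigen_lam => // m e i.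
move=> [s /= /eqP size_s] m_gt1 simple_e _ deg_i [/= sorted_s char_s].
rewrite -natr1 addrK /=; rewrite ltnS in m_gt1; rewrite /= in deg_i.
have bound := eigenvalue_deflation_bound m_gt1 simple_e deg_i.
have max_ge0 : 0 <= max_radius R e i.
  by rewrite /max_radius; elim/big_rec: _ => // p x _ x0; rewrite le_max x0 orbT.
have row_sum j : \sum_k normalized_adjacency_mx R e j k = 1.
  have deg_gt0 l : (0 < degree e l)%N.
    by apply: (degree_dominated_gt0 l _ simple_e deg_i); apply: ltnW.
  under eq_bigr => k _ do rewrite normalized_adjacency_mxE //.
  by rewrite -mulr_suml sum_adjacency divff // pnatr_eq0 -lt0n.
have := char_poly_deflation i row_sum; rewrite char_s.
move: bound; set B := deflation _ _ => bound char_eq.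
have s_bound x : x \in s -> x != 1 -> `|x + 1 / m%:R| <= max_radius R e i.
  move=> x_s x1; apply: bound; move: x_s.
  by rewrite -root_prod_XsubC char_eq rootM root_XsubC (negbTE x1).
have minv_ge0 : 0 <= 1 / m%:R :> R by rewrite divr_ge0.
split.
  (* The eigenvalue 1 may escape the disk, but it lies above the lower bound, which is
     nonpositive. *)
  case: (eqVneq s`_m 1) => [->|last_neq1].
    by have := max_ge0; lra.
  have /s_bound /(_ last_neq1) : s`_m \in s by rewrite mem_nth // size_s.
  by rewrite ler_norml => /andP [? _]; lra.
case: s size_s sorted_s char_eq s_bound {char_s} => [|a [|b s]] //=.
  by move=> [m0]; rewrite -m0 in m_gt1.
move=> _ /andP [ba _] char_eq s_bound.
(* If the largest eigenvalue is 1, cancelling one factor X - 1 leaves the second as a root for the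
   deflation, even when it is 1 again. Otherwise the largest one already obeys the bound, and the
   second is no larger. *)
case: (eqVneq a 1) => [a1|a_neq1].
  have : `|b + 1 / m%:R| <= max_radius R e i.
    rewrite a1 big_cons in char_eq.
    have E := mulfI (negbT (polyXsubC_eq0 1)) char_eq; apply: bound.
    by rewrite -E root_prod_XsubC mem_head.
  by rewrite ler_norml => /andP [_ ?]; lra.
have := s_bound a (mem_head _ _) a_neq1.
by rewrite ler_norml => /andP [_ ?]; lra.
Qed.
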